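(* Let $R=\{(0,1),(0,2),(1,1),(1,2),(3,0),(3,1),(3,2),(3,3)\}$ and let $\mathrm{P}_9=(123,R)$ and $\mathrm{P}_{10}=(132,R)$ be mesh patterns. For every $n\ge 1$ and all integers $k,\ell\ge 0$, $$|\{\sigma\in\mathfrak{S}_n: \mathrm{P}_9(\sigma)=k,\ \mathrm{P}_{10}(\sigma)=\ell\}| = |\{\sigma\in\mathfrak{S}_n: \mathrm{P}_{10}(\sigma)=k,\ \mathrm{P}_9(\sigma)=\ell\}|.$$
   Context: $\mathfrak{S}_n$ is the set of permutations $\sigma=\sigma_1\sigma_2\cdots\sigma_n$ of $[n]=\{1,\dots,n\}$ in one-line notation. A mesh pattern is a pair $p=(\pi,R)$ with $\pi\in\mathfrak{S}_m$ and $R\subseteq\{0,\dots,m\}\times\{0,\dots,m\}$ (the set of shaded unit cells, each given by its bottom-left corner, in the grid with dots at $(i,\pi_i)$). An occurrence of $p$ in $\sigma\in\mathfrak{S}_n$ is a choice of indices $i_1<\cdots<i_m$ such that $\sigma_{i_1}\cdots\sigma_{i_m}$ is order-isomorphic to $\pi$ and, for every $(a,b)\in R$, there is no index $r$ with $i_a<r<i_{a+1}$ and $v_b<\sigma_r<v_{b+1}$; here $v_1<\cdots<v_m$ is the increasing rearrangement of $\sigma_{i_1},\dots,\sigma_{i_m}$, $i_0=v_0=0$ and $i_{m+1}=v_{m+1}=n+1$. $p(\sigma)$ denotes the number of occurrences of $p$ in $\sigma$. *)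

(* Defs.v *)
From mathcomp Require Import all_boot all_fingroup.

Set Implicit Arguments.
Unset Strict Implicit.
Unset Printing Implicit Defensive.

(* Permutations of [n] are elements of 'S_n, that is of
   permutations of {0, ..., n-1}; the ordinal i stands for the label i.+1 of
   [n].  Positions and values are shifted back to 1, ..., n in the definitions
   below, so that 0 and n.+1 are available as the sentinels i_0 = v_0 and
   i_(m+1) = v_(m+1). *)

Record mesh_pattern (m : nat) := MeshPattern {
  mesh_perm : 'S_m;
  (* lower-left corners of the shaded cells, as (column, row) *)
  mesh_shading : {set 'I_m.+1 * 'I_m.+1}
}.

Section Occurrences.

Variables (m n : nat).
Implicit Types (p : mesh_pattern m) (sigma : 'S_n) (f : {ffun 'I_m -> 'I_n}).

Definition one_based (x : 'I_n) : nat := x.+1.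

Definition strictly_increasing f : bool :=
  [forall a : 'I_m, forall b : 'I_m, (a < b) ==> (f a < f b)].

Definition order_isomorphic (pi : 'S_m) sigma f : bool :=
  [forall a : 'I_m, forall b : 'I_m,
     (sigma (f a) < sigma (f b)) == (pi a < pi b)].

(* i_0, i_1, ..., i_m, i_(m+1) *)
Definition index_bounds f : seq nat :=
  0 :: rcons [seq one_based (f a) | a : 'I_m] n.+1.

(* v_0, v_1, ..., v_m, v_(m+1) *)
Definition value_bounds sigma f : seq nat :=
  0 :: rcons (sort leq [seq one_based (sigma (f a)) | a : 'I_m]) n.+1.

(* The point (r, sigma_r) lies in the cell with lower-left corner (a, b). *)
Definition in_cell sigma f (a b : nat) (r : 'I_n) : bool :=
  (nth 0 (index_bounds f) a < one_based r < nth 0 (index_bounds f) a.+1) &&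
  (nth 0 (value_bounds sigma f) b < one_based (sigma r)
     < nth 0 (value_bounds sigma f) b.+1).

Definition is_occurrence p sigma f : bool :=
  [&& strictly_increasing f,
      order_isomorphic (mesh_perm p) sigma f
    & [forall c in mesh_shading p,
         ~~ [exists r : 'I_n, in_cell sigma f c.1 c.2 r]]].

Definition occurrences p sigma : nat :=
  #|[set f : {ffun 'I_m -> 'I_n} | is_occurrence p sigma f]|.

End Occurrences.

Definition perm123 : 'S_3 := 1%g.
Definition perm132 : 'S_3 := tperm (@Ordinal 3 1 isT) (@Ordinal 3 2 isT).

Lemma perm123_one_line : [seq one_based (perm123 a) | a : 'I_3] = [:: 1; 2; 3].
Proof. by rewrite /image_mem enum_ordSl enum_ordSl enum_ordSl enum_ord0 /= !perm1. Qed.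

Lemma perm132_one_line : [seq one_based (perm132 a) | a : 'I_3] = [:: 1; 3; 2].
Proof.
by rewrite /image_mem enum_ordSl enum_ordSl enum_ordSl enum_ord0 /= !permE.
Qed.

Definition shadingR : {set 'I_4 * 'I_4} :=
  [set c : 'I_4 * 'I_4 | (val c.1, val c.2) \in
     [:: (0, 1); (0, 2); (1, 1); (1, 2); (3, 0); (3, 1); (3, 2); (3, 3)]].

Definition P9 : mesh_pattern 3 := MeshPattern perm123 shadingR.
Definition P10 : mesh_pattern 3 := MeshPattern perm132 shadingR.

(* Main.v *)
Require Import Defs.
From mathcomp Require Import all_boot all_fingroup.
From mathcomp Require Import zify.

(** Let [c] be the last value of [sigma].  Column 3 being shaded, an occurrence
    of either pattern ends at the last entry, and its other two entries
    [sigma i], [sigma j] are such that [sigma i] is the largest value below [c]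
    before position [j], while no value before position [j] lies strictly
    between [sigma j] and [c].  Hence [i] is determined by [j], and the
    occurrences correspond to the positions [j] at which [sigma j] is nearer to
    [c] than all earlier values on its side of [c], some value below [c] having
    appeared before ([is_record]; the bijection is [occurrences_records]).
    Records below [c] count P9, those above [c] count P10.

    Now build a permutation from its last entry by inserting the other entries
    in order of position, from left to right, each into one of the gaps between
    the values already present.  As soon as [c] is not the minimum, insertion
    into the gap just below [c] creates a record below, insertion into the gap
    just above [c] creates a record above, and any other gap creates none
    ([is_record_insert_new]); the number of other gaps depends only on the
    number of entries.  While [c] is the minimum no record is created.
    This rule is invariant under exchange of the two kinds of records, so their
    joint distribution is symmetric, by induction on the length
    ([sum_records_sym]).  In the induction it must be remembered whether [c] is
    the minimum. *)

Set Implicit Arguments.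
Unset Strict Implicit.
Unset Printing Implicit Defensive.

(** * Occurrences as records *)

(** Indexed by whether the middle entry of an occurrence exceeds its last
    entry, so that both patterns share one argument. *)
Definition pattern (above : bool) : mesh_pattern 3 := if above then P10 else P9.

Definition o0 : 'I_3 := @Ordinal 3 0 isT.
Definition o1 : 'I_3 := @Ordinal 3 1 isT.
Definition o2 : 'I_3 := @Ordinal 3 2 isT.

Lemma ord3P (i : 'I_3) : [\/ i = o0, i = o1 | i = o2].
Proof.
by case: i => [[|[|[|//]]] Hi]; [constructor 1|constructor 2|constructor 3];
  apply: val_inj.
Qed.

Lemma map_ord3 (T : Type) (g : 'I_3 -> T) :
  [seq g a | a : 'I_3] = [:: g o0; g o1; g o2].
Proof.
rewrite /image_mem enum_ordSl enum_ordSl enum_ordSl enum_ord0 /=.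
by congr [:: g _; g _; g _]; apply: val_inj.
Qed.

Lemma strictly_increasing3 n (f : {ffun 'I_3 -> 'I_n}) :
  strictly_increasing f = (f o0 < f o1 < f o2).
Proof.
apply/idP/idP => [/forallP inc | /andP[lt01 lt12]].
  by rewrite (implyP (forallP (inc o0) o1) isT) (implyP (forallP (inc o1) o2) isT).
apply/forallP => a; apply/forallP => b; apply/implyP.
by case: (ord3P a) => ->; case: (ord3P b) => -> //= _; apply: ltn_trans lt12.
Qed.

Section Occurrences.

Variables (n : nat) (sigma : 'S_n.+1).
Implicit Types (above : bool) (f : {ffun 'I_3 -> 'I_n.+1}) (i j r : 'I_n.+1).

Let c : 'I_n.+1 := sigma ord_max.

Lemma perm_neq_nat i j : i != j :> nat -> sigma i != sigma j :> nat.
Proof. by apply: contra_neq => /val_inj /perm_inj ->. Qed.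

Lemma order_isomorphic_pattern above f :
  order_isomorphic (mesh_perm (pattern above)) sigma f =
  if above then sigma (f o0) < sigma (f o2) < sigma (f o1)
  else sigma (f o0) < sigma (f o1) < sigma (f o2).
Proof.
have t0 : perm132 o0 = o0 by rewrite permE.
have t1 : perm132 o1 = o2 by rewrite permE.
have t2 : perm132 o2 = o1 by rewrite permE.
apply/idP/idP.
  move/forallP => iso.
  have h a b := eqP (forallP (iso a) b).
  by case: above h {iso} => h; rewrite !h /= ?perm1 ?t0 ?t1 ?t2.
move=> lts; apply/forallP => a; apply/forallP => b.
by case: above lts => lts; case: (ord3P a) => ->; case: (ord3P b) => ->;
   rewrite /= ?perm1 ?t0 ?t1 ?t2 /=; lia.
Qed.

Lemma index_bounds3 f :
  index_bounds f = [:: 0; (f o0).+1; (f o1).+1; (f o2).+1; n.+2].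
Proof. by rewrite /index_bounds map_ord3. Qed.

Lemma value_bounds_pattern above f :
    order_isomorphic (mesh_perm (pattern above)) sigma f ->
  value_bounds sigma f =
  [:: 0; (sigma (f o0)).+1; (minn (sigma (f o1)) (sigma (f o2))).+1;
      (maxn (sigma (f o1)) (sigma (f o2))).+1; n.+2].
Proof.
rewrite order_isomorphic_pattern /value_bounds map_ord3 => lts.
set s := sort _ _.
suff -> : s = [:: (sigma (f o0)).+1; (minn (sigma (f o1)) (sigma (f o2))).+1;
      (maxn (sigma (f o1)) (sigma (f o2))).+1] by [].
rewrite /s /one_based; apply: (sorted_eq leq_trans anti_leq).
- by apply: sort_sorted; apply: leq_total.
- by case: above lts => lts /=; lia.
rewrite perm_sort perm_cons.
case: above lts => lts; last first.
  by rewrite (minn_idPl _) ?(maxn_idPr _) //; lia.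
rewrite (minn_idPr _) ?(maxn_idPl _) //; [|lia..].
by rewrite -[X in perm_eq X _]cat1s perm_catC.
Qed.

(** The cells in columns 0 and 1 say that no entry to the left of [f o1] has its
    value strictly between the extreme values of the occurrence: the middle
    value is taken by [f o1] or [f o2], so rows 1 and 2 need not be
    separated. *)
Lemma is_occurrence_pattern above f :
  reflect [/\ f o0 < f o1 < n, f o2 = ord_max,
              sigma (f o0) < minn c (sigma (f o1)), (c < sigma (f o1)) = above
            & forall r, r < f o1 ->
                ~~ (sigma (f o0) < sigma r < maxn c (sigma (f o1)))]
          (is_occurrence (pattern above) sigma f).
Proof.
have shP q : (q \in mesh_shading (pattern above)) = (q \in shadingR).
  by case: above.
rewrite /is_occurrence strictly_increasing3.
apply: (iffP and3P).
  case=> inc iso /forallP noR.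
  have cellN a b r (ha : a < 4) (hb : b < 4) :
      (a, b) \in [:: (0, 1); (0, 2); (1, 1); (1, 2); (3, 0); (3, 1); (3, 2); (3, 3)] ->
      in_cell sigma f a b r = false.
    move=> hab; have := noR (Ordinal ha, Ordinal hb).
    rewrite shP inE hab /= => /existsPn /(_ r) /negbTE; exact.
  move: (iso); rewrite order_isomorphic_pattern => lts.
  have cellE := value_bounds_pattern iso.
  (* Otherwise the last entry of sigma lies in a cell of column 3. *)
  have f2 : f o2 = ord_max.
    apply/eqP; rewrite -val_eqE /=.
    have hr : forall b, b < 4 -> in_cell sigma f 3 b ord_max = false.
      by case=> [|[|[|[|//]]]] _; apply: cellN.
    have ne i : i < n -> sigma i != sigma ord_max :> nat.
      by move=> lt; apply: perm_neq_nat => /=; lia.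
    apply/negPn/negP => lt2.
    have lt2n : f o2 < n by have := ltn_ord (f o2); lia.
    have := ne _ lt2n.
    have := ne (f o1) ltac:(lia).
    have := ne (f o0) ltac:(lia).
    have := ltn_ord (sigma ord_max).
    have := hr 0 isT; have := hr 1 isT; have := hr 2 isT; have := hr 3 isT.
    rewrite /in_cell index_bounds3 cellE /one_based /=.
    lia.
  rewrite f2 /= in inc lts cellE; split=> //.
  - by case: above lts {shP noR iso} => lts; rewrite /c; lia.
  - by case: above lts {shP noR iso} => lts; rewrite /c; lia.
  move=> r ltr.
  have ne1 : sigma (f o1) != sigma r :> nat by apply: perm_neq_nat; lia.
  have nem : sigma ord_max != sigma r :> nat by apply: perm_neq_nat => /=; lia.
  case: (eqVneq (f o0) r) => [->|]; first by rewrite ltnn.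
  rewrite -val_eqE /= => ne0.
  have := cellN 0 1 r isT isT isT; have := cellN 0 2 r isT isT isT.
  have := cellN 1 1 r isT isT isT; have := cellN 1 2 r isT isT isT.
  rewrite /in_cell index_bounds3 cellE f2 /one_based /=.
  rewrite /c; lia.
case=> /andP[lt01 lt1n] f2 small side between.
have iso : order_isomorphic (mesh_perm (pattern above)) sigma f.
  have ne : sigma (f o1) != sigma ord_max :> nat by apply: perm_neq_nat => /=; lia.
  rewrite order_isomorphic_pattern f2.
  by case: above side {shP} => side; rewrite /c in small side; lia.
split=> //; first by rewrite lt01 f2.
apply/forallP => -[a b]; rewrite shP inE; apply/implyP => /= hab.
apply/existsPn => r; rewrite /in_cell index_bounds3 (value_bounds_pattern iso).
have := between r; rewrite /one_based f2.
have := ltn_ord r; rewrite /c in small *.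
move: hab; rewrite !inE !xpair_eqE.
by repeat case/orP; case/andP => /eqP -> /eqP -> /=; lia.
Qed.

Definition is_record above j : bool :=
  [&& sigma j != c, (c < sigma j) == above,
      [exists i : 'I_n.+1, (i < j) && (sigma i < c)]
    & [forall i : 'I_n.+1, (i < j) ==> ~~ (minn c (sigma j) < sigma i < maxn c (sigma j))]].

Definition records above : nat := \sum_(j < n.+1) is_record above j.

(** An occurrence is determined by its middle position: its first entry is the
    largest value below [c] to the left of it. *)
Lemma occurrences_records above :
  occurrences (pattern above) sigma = records above.
Proof.
have -> : records above = #|[set j | is_record above j]|.
  by rewrite -sum1dep_card big_mkcond.
rewrite /occurrences.
have <- : [set (f : {ffun 'I_3 -> 'I_n.+1}) o1 | f in [set f | is_occurrence (pattern above) sigma f]]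
     = [set j | is_record above j].
  apply/setP => j; rewrite inE; apply/imsetP/idP.
    case=> f; rewrite inE => /is_occurrence_pattern[/andP[lt01 lt1n] f2 small side between] ->.
    have ne : sigma (f o1) != c :> nat by apply: perm_neq_nat => /=; lia.
    apply/and4P; split=> //; first exact/eqP.
      by apply/existsP; exists (f o0); move: small; rewrite lt01 ltn_min => /andP[].
    by apply/forallP => i; apply/implyP => /between; lia.
  case/and4P=> ne /eqP side /existsP[i0 small0] /forallP near.
  pose P i := (i < j) && (sigma i < c).
  case: (@arg_maxnP _ i0 P (fun i => sigma i) small0) => i /andP[lti smalli] maxi.
  exists [ffun a : 'I_3 => if a == o0 then i else if a == o1 then j else ord_max];
    last by rewrite ffunE.
  have nej : j < n.
    rewrite ltn_neqAle -ltnS ltn_ord andbT.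
    by apply: contra_neq ne => ej; congr (sigma _); apply: val_inj.
  rewrite inE; apply/is_occurrence_pattern; rewrite !ffunE /=; split=> //; first by rewrite lti.
    have := near i; rewrite lti /=.
    have : sigma i != sigma j :> nat by apply: perm_neq_nat; lia.
    lia.
  move=> r ltr; have := maxi r; rewrite /P ltr /=.
  have := near r; rewrite ltr /=.
  have : sigma r != c :> nat by apply: perm_neq_nat => /=; lia.
  lia.
rewrite card_in_imset // => f g; rewrite !inE.
move=> /is_occurrence_pattern[/andP[lf _] f2 sf _ bf] /is_occurrence_pattern[/andP[lg _] g2 sg _ bg] e1.
have e0 : f o0 = g o0.
  apply: (@perm_inj _ sigma); apply: val_inj => /=.
  rewrite e1 in lf sf bf.
  by have := bf _ lg; have := bg _ lf; lia.
by apply/ffunP => a; case: (ord3P a) => ->; rewrite ?e0 ?e1 ?f2 ?g2.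
Qed.

End Occurrences.

(** * Insertion of an entry before the last one *)

Section Insert.

Variables (n : nat) (v : 'I_n.+2) (s : 'S_n.+1).

Definition penult : 'I_n.+2 := lift ord_max ord_max.

Lemma lift_penult_max : lift penult ord_max = ord_max.
Proof. by apply: val_inj; rewrite /= /bump; lia. Qed.

Lemma lift_lt m (h : 'I_m.+1) (i j : 'I_m) : (lift h i < lift h j) = (i < j).
Proof. by rewrite /= /bump; lia. Qed.

Let t := lift_perm penult v s.
Let c : 'I_n.+1 := s ord_max.

Lemma insert_last : t ord_max = lift v c.
Proof. by rewrite -lift_penult_max lift_perm_lift. Qed.

(** A record looks only to its left and at the last entry, so the insertion
    does not affect the entries before the new one; the last entry itself is
    never a record. *)
Lemma is_record_insert_old above k :
  is_record t above (lift penult k) = is_record s above k.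
Proof.
rewrite /is_record insert_last lift_perm_lift lift_lt (inj_eq lift_inj).
rewrite -/c; case: (eqVneq (s k) c) => //= ne; case: (_ == above) => //=.
have ltp : lift penult k < penult.
  rewrite ltn_neqAle -[_ == _ :> nat]/(_ == _ :> 'I__) eq_sym neq_lift /=.
  have : k != ord_max by apply: contra_neq ne => ->.
  have := ltn_ord k; rewrite -val_eqE /= /bump; lia.
congr (_ && _).
  apply/existsP/existsP => -[i]; last first.
    by move=> h; exists (lift penult i); rewrite lift_perm_lift !lift_lt.
  case: (unliftP penult i) => [i' ->|->]; last by rewrite [penult < _]ltnNge (ltnW ltp).
  by rewrite lift_perm_lift !lift_lt; exists i'.
apply/forallP/forallP => near i.
  have := near (lift penult i).
  by rewrite lift_perm_lift lift_lt !(gtn_min, leq_max, lift_lt).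
case: (unliftP penult i) => [i' ->|->]; last by rewrite [penult < _]ltnNge (ltnW ltp).
rewrite lift_perm_lift lift_lt.
have := near i'.
by rewrite !(gtn_min, leq_max, lift_lt).
Qed.

(** All entries but the last precede the new one.  So a smaller value than the
    last one occurs before it iff [c != 0], and it is nearest to the last value
    iff its value is adjacent: the insertion of [v] raises [c] when [v <= c], so
    [v = c] places the new entry just below and [v = c + 1] just above. *)
Lemma is_record_insert_new above :
  is_record t above penult = (c != 0 :> nat) && (v == c + above :> nat).
Proof.
have lt_max (i : 'I_n.+1) : (lift penult i < penult) = (i != ord_max).
  have := ltn_ord i; rewrite -val_eqE /= /bump; lia.
have exE : [exists i : 'I_n.+2, (i < penult) && (t i < lift v c)] = (c != 0 :> nat).
  apply/existsP/idP => [[i]|c_gt0].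
    case: (unliftP penult i) => [i' ->|->]; last by rewrite ltnn.
    by rewrite lift_perm_lift lift_lt => /andP[_]; lia.
  exists (lift penult (s^-1 ord0)%g).
  rewrite lift_perm_lift lift_lt permKV lt_max /= lt0n c_gt0 andbT.
  by apply: contra_neq c_gt0 => /(congr1 s); rewrite permKV -/c => <-.
have -> : is_record t above penult = [&& (lift v c < v) == above, c != 0 :> nat
    & [forall i : 'I_n.+2, (i < penult) ==>
         ~~ (minn (lift v c) v < t i < maxn (lift v c) v)]].
  by rewrite /is_record insert_last lift_perm_id neq_lift exE.
rewrite andbCA; congr (_ && _); apply/andP/eqP.
  case=> /eqP <- /forallP near.
  (* An old entry w other than c may not end up between the new one and c. *)
  have gapP (w : 'I_n.+1) : w != c ->
      ~~ (minn (lift v c) v < lift v w < maxn (lift v c) v).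
    move=> ne; have := near (lift penult (s^-1 w)%g).
    rewrite lift_perm_lift permKV lt_max => /implyP; apply.
    by apply: contra_neq ne; rewrite /c => <-; rewrite permKV.
  (* If v < c, the old value v becomes v + 1, strictly between v and c + 1;
     if v > c + 1, the old value c + 1 lies between c and v. *)
  have [/= lt|le] := ltnP v c.
    have := gapP (inord v); rewrite -val_eqE /= inordK; last by have := ltn_ord c; lia.
    rewrite /bump; lia.
  have [lt|le'] := ltnP c.+1 v.
    have := gapP (inord c.+1); rewrite -val_eqE /= inordK; last by have := ltn_ord v; lia.
    rewrite /bump; lia.
  rewrite /= /bump; lia.
move=> vE; split.
  by rewrite /= /bump vE; case: above {vE} => /=; lia.
apply/forallP => i; apply/implyP => _.
by rewrite /= /bump vE; case: above {vE} => /=; lia.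
Qed.

Lemma records_insert above :
  records t above = records s above + ((c != 0 :> nat) && (v == c + above :> nat)).
Proof.
rewrite /records (bigD1_ord penult) //= is_record_insert_new addnC.
by congr (_ + _); apply: eq_bigr => k _; rewrite is_record_insert_old.
Qed.

End Insert.

(** * Symmetry of the joint distribution *)

(** Injectivity of insertion suffices since (n + 2)! = (n + 1)! (n + 2). *)
Lemma sum_insert n (F : 'S_n.+2 -> nat) :
  \sum_s F s = \sum_(s : 'S_n.+1) \sum_(v < n.+2) F (lift_perm (penult n) v s).
Proof.
rewrite pair_big /=.
pose h (p : 'S_n.+1 * 'I_n.+2) := lift_perm (penult n) p.2 p.1.
have h_inj : injective h.
  move=> [s v] [s' v'] /permP eqh.
  have ev : v = v' by have := eqh (penult n); rewrite !lift_perm_id.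
  congr (_, _) => //; apply/permP => k; apply: (@lift_inj _ v).
  by have := eqh (lift (penult n) k); rewrite !lift_perm_lift -ev.
rewrite (reindex h) //; apply: onW_bij; apply: inj_card_bij h_inj _.
by rewrite card_prod !card_Sn card_ord factS mulnC.
Qed.

(** The total weight of the insertions into a permutation with statistics [p]
    and [q], where [b] tells whether the last value is not the minimum, if [F]
    weighs the results.  With [b] true, [n] gaps are not adjacent to the last
    value; with [b] false, only the gap below the last value makes it
    non-minimal. *)
Definition insertion_step n (F : bool -> nat -> nat -> nat) (b : bool) (p q : nat) :=
  if b then F true p.+1 q + (F true p q.+1 + n * F true p q)
  else F true p q + n.+1 * F false p q.

(** One function [insertion_step n F] serves both values of [above]: this is
    where the two kinds of records are exchanged. *)
Lemma sum_insertions n (F : bool -> nat -> nat -> nat) above (s : 'S_n.+1) :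
  \sum_(v < n.+2)
     (let t := lift_perm (penult n) v s in
      F (t ord_max != 0 :> nat) (records t above) (records t (~~ above))) =
  insertion_step n F (s ord_max != 0 :> nat) (records s above) (records s (~~ above)).
Proof.
under eq_bigr => v _ do rewrite /= insert_last !records_insert.
rewrite /insertion_step; case: (eqVneq (s ord_max : nat) 0) => [c0|c_gt0] /=.
  rewrite big_ord_recl /= /bump c0 !addn0; congr (_ + _).
  by rewrite -[X in X * _](card_ord n.+1) -sum_nat_const; apply: eq_bigr.
have lt_c (a : bool) : s ord_max + a < n.+2
  by rewrite -addSn -[n.+2]addn1 leq_add ?leq_b1.
pose gap a := Ordinal (lt_c a).
have gap_neq : gap above != gap (~~ above).
  by rewrite -val_eqE /= eqn_add2l; case: (above).
have last_pos (v : nat) : (bump v (s ord_max) != 0) = true by rewrite /bump; lia.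
have gapE (a : bool) (v : 'I_n.+2) : (v == s ord_max + a :> nat) = (v == gap a) by [].
under eq_bigr => v _ do rewrite last_pos !gapE.
rewrite (bigD1 (gap above)) // (bigD1 (gap (~~ above))) /=; last by rewrite eq_sym.
rewrite !eqxx (negbTE gap_neq) eq_sym (negbTE gap_neq) !addn0 !addn1.
congr (_ + (_ + _)).
under eq_bigr => v /andP[/negbTE ne /negbTE ne'] do rewrite ne ne' !addn0.
rewrite sum_nat_const; congr (_ * _).
have := cardC (pred2 (gap above) (gap (~~ above))).
rewrite card2 gap_neq card_ord => -[card_n]; rewrite -[RHS]card_n.
by apply: eq_card => v; rewrite !inE negb_or.
Qed.

(** The weight [F] is arbitrary so that the induction hypothesis applies to
    [insertion_step n F]. *)
Lemma sum_records_sym n (F : bool -> nat -> nat -> nat) :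
  \sum_(s : 'S_n.+1) F (s ord_max != 0 :> nat) (records s false) (records s true) =
  \sum_(s : 'S_n.+1) F (s ord_max != 0 :> nat) (records s true) (records s false).
Proof.
elim: n F => [|n IHn] F.
  apply: eq_bigr => s _; suff r0 a : records s a = 0 by rewrite !r0.
  by rewrite /records big_ord1 /is_record [ord0](_ : _ = ord_max) ?eqxx //; apply: val_inj.
rewrite !sum_insert.
under eq_bigr => s _ do rewrite (sum_insertions F false).
under [RHS]eq_bigr => s _ do rewrite (sum_insertions F true).
exact: IHn.
Qed.

Theorem mainTheorem5 (n k l : nat) (n_ge1 : 1 <= n) :
  #|[set sigma : 'S_n | (occurrences P9 sigma == k) && (occurrences P10 sigma == l)]| =
  #|[set sigma : 'S_n | (occurrences P10 sigma == k) && (occurrences P9 sigma == l)]|.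
Proof.
case: n n_ge1 => // n _.
have := sum_records_sym n (fun _ p q => (p == k) && (q == l)).
rewrite -!sum1dep_card ![\sum_(_ | _) _]big_mkcond /=.
under eq_bigr => s _ do rewrite -!occurrences_records.
by under [RHS]eq_bigr => s _ do rewrite -!occurrences_records.
Qed.
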